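(* Let $\mathsf{CS}$ be a constant specification for $\mathsf{FOLP}$ and let $A$ be a sentence of $\mathsf{FOLP}$. If $A$ has an $\mathsf{FOLP}_{\mathsf{CS}}$-tableau proof, then $A$ is $\mathsf{FOLP}_{\mathsf{CS}}$-valid, i.e. $A$ is true in every (Mkrtychev) $\mathsf{FOLP}_{\mathsf{CS}}$-model.
   Context: **Language.** $Var$ is a countable set of individual variables $x,y,\dots$; there are no constant symbols, function symbols or identity. Justification terms: $t::=p\mid c\mid t+t\mid t\cdot t\mid {!t}\mid gen_x(t)$, with $p$ in a countable set $JVar$ of justification variables, $c$ in a countable set $JCons$ of justification constants, $x\in Var$. $\mathsf{FOLP}$ formulas: $A::=Q(x_1,\dots,x_n)\mid\neg A\mid A\to A\mid\forall xA\mid\exists xA\mid t:_XA$, where $Q$ is an $n$-place predicate symbol (countably many, of any arity), $t$ is a term, $X\subseteq Var$ is a finite set. Free occurrences are as in first order logic, and additionally the free occurrences in $t:_XA$ are the free occurrences in $A$ of variables belonging to $X$, together with all occurrences in $X$ itself; so $FVar(t:_XA)=X$. Accordingly, substituting for $x$ in $t:_XA$ replaces $x$ in $X$ and at its free occurrences in $A$ if $x\in X$, and changes nothing if $x\notin X$. A sentence is a formula with no free individual variables. $t:A$ means $t:_\emptyset A$. $Xy$ means $X\cup\{y\}$ and implies $y\notin X$. $\forall A$ is the universal closure of $A$ (over its free individual variables). **$K$-formulas.** For a nonempty set $K$, a $K$-formula is the result of substituting members of $K$ for some free individual variables of an $\mathsf{FOLP}$ formula; it is closed if it has no free occurrences of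 individual variables; $K(A)$ is the set of members of $K$ occurring in $A$. $A(a)$ denotes the result of replacing all free occurrences of $x$ in $A(x)$ by $a$. **Axioms and constant specifications.** The axioms of $\mathsf{FOLP}$ are all instances of: axiom schemes of (a standard axiomatization of) first order logic; $t:_{Xy}A\to t:_XA$ with $y\notin FVar(A)$; $t:_XA\to t:_{Xy}A$; $s:_XA\to(s+t):_XA$ and $s:_XA\to(t+s):_XA$; $s:_X(A\to B)\to(t:_XA\to(s\cdot t):_XB)$; $t:_XA\to A$; $t:_XA\to{!t}:_Xt:_XA$; $t:_XA\to gen_x(t):_X\forall xA$ with $x\notin X$. A constant specification $\mathsf{CS}$ is a set of formulas $c:A$ with $c$ a justification constant and $A$ an axiom instance. **Models.** An $\mathsf{FOLP}_{\mathsf{CS}}$-model is $\mathcal M=(\mathcal D,\mathcal I,\mathcal E)$ with $\mathcal D$ a nonempty set, $\mathcal I$ assigning to each $n$-place predicate symbol an $n$-ary relation on $\mathcal D$, and $\mathcal E$ assigning to each justification term a set of $\mathcal D$-formulas such that: ($\mathcal E1$) $c:A\in\mathsf{CS}$ implies $A\in\mathcal E(c)$; ($\mathcal E2$) $A\to B\in\mathcal E(s)$ and $A\in\mathcal E(t)$ imply $B\in\mathcal E(s\cdot t)$; ($\mathcal E3$) $\mathcal E(s)\cup\mathcal E(t)\subseteq\mathcal E(s+t)$; ($\mathcal E4$) $A\in\mathcal E(t)$ implies $t:_XA\in\mathcal E(!t)$ whenever $\mathcal D(A)\subseteq X\subseteq\mathcal D$; ($\mathcal E5$) $A\in\mathcal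 E(t)$ implies $\forall xA\in\mathcal E(gen_x(t))$; ($\mathcal E6$) $a\in\mathcal D$ and $A(x)\in\mathcal E(t)$ imply $A(a)\in\mathcal E(t)$. Truth of closed $\mathcal D$-formulas: $\mathcal M\Vdash Q(\vec a)$ iff $\vec a\in\mathcal I(Q)$; $\neg,\to$ classically; $\mathcal M\Vdash\forall xA(x)$ (resp. $\exists xA(x)$) iff $\mathcal M\Vdash A(a)$ for every (resp. some) $a\in\mathcal D$; $\mathcal M\Vdash t:_XA$ iff $A\in\mathcal E(t)$ and $\mathcal M\Vdash\forall A$. **Tableaux.** $Par$ is a denumerable set of new individual variables (parameters $\mathsf u,\mathsf v,\dots$), disjoint from $Var$ and never quantified; a $Par$-formula is the result of substituting parameters for some free individual variables of an $\mathsf{FOLP}$ formula, it is closed if it has no free occurrences of individual variables from $Var$ (it may contain parameters), and $Par(A)$ is the set of parameters occurring in $A$. An $\mathsf{FOLP}_{\mathsf{CS}}$-tableau for a finite set $S$ of closed $Par$-formulas is a binary tree labeled by closed $Par$-formulas, starting with a single branch consisting of the formulas of $S$, and obtained by finitely many applications of the following rules to formulas occurring on a branch (the conclusions extend the branch; ''$|$'' splits it). In the rules for justification formulas $X\subseteq Par$. - $(F\neg)$: $\neg\neg A$ / $A$. - $(T\to)$: $A\to B$ / $\neg A\mid B$. $(F\to)$: $\neg(A\to B)$ / $A,\neg B$. - $(T\forall)$: $\forall xA(x)$ / $A(\mathsf u)$, any parameter $\mathsf u$. $(F\exists)$: $\neg\exists xA(x)$ / $\neg A(\mathsf u)$, any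 parameter $\mathsf u$. - $(T\exists)$: $\exists xA(x)$ / $A(\mathsf u)$, $\mathsf u$ new to the branch. $(F\forall)$: $\neg\forall xA(x)$ / $\neg A(\mathsf u)$, $\mathsf u$ new to the branch. - $(T:)$: $t:_XA$ / $\forall A$. - $(F+)$: $\neg\,t+s:_XA$ / $\neg t:_XA,\ \neg s:_XA$. - $(F\cdot)$: $\neg\,s\cdot t:_XB$ / $\neg s:_X(A\to B)\mid\neg t:_XA$, for any $Par$-formula $A$ with $Par(A)\subseteq X$. - $(F!)$: $\neg\,{!t}:_Xt:_XA$ / $\neg t:_XA$. - $(Ctr)$: $\neg t:_XA$ / $\neg t:_{X\mathsf u}A$. - $(Exp)$: $\neg t:_{X\mathsf u}A$ / $\neg t:_XA$, provided $\mathsf u\notin Par(A)$. - $(Ins)$: $\neg t:_XA(\mathsf u)$ / $\neg t:_XA(x)$, where $A(\mathsf u)$ is $A(x)$ with all free occurrences of $x$ replaced by $\mathsf u$. - $(gen_x)$: $\neg gen_x(t):_X\forall xA$ / $\neg t:_XA$. A branch closes if it contains both $A$ and $\neg A$ for some closed $Par$-formula $A$, or contains $\neg c:A$ for some $c:A\in\mathsf{CS}$. A tableau closes if all its branches close. An $\mathsf{FOLP}_{\mathsf{CS}}$-tableau proof of a sentence $F$ is a closed tableau for $\{\neg F\}$. *)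

(* Defs.v *)
From HB Require Import structures.
From mathcomp Require Import all_boot finmap boolp.

Set Implicit Arguments.
Unset Strict Implicit.
Unset Printing Implicit Defensive.

Local Open Scope fset_scope.

Notation Var := nat (only parsing).
Notation JVar := nat (only parsing).
Notation JCons := nat (only parsing).

Inductive term : Type :=
  | TVar of JVar
  | TCst of JCons
  | TSum of term & term
  | TApp of term & term
  | TBang of term
  | TGen of Var & term.

(* Formulas whose individual symbols are variables ([inl x]) or members of [K]
   ([inr a]).  [Atom i v] is the [i]-th [n]-place predicate symbol applied to
   [v].  The FOLP formulas are [form void]; [K]-formulas are singled out in
   [form K] by [kform] below, which excludes for instance t:_{} Q(a). *)
Inductive form (K : choiceType) : Type :=
  | Atom (n i : nat) of n.-tuple (Var + K)%type
  | Neg of form K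
  | Imp of form K & form K
  | All of Var & form K
  | Ex of Var & form K
  | Just of term & {fset (Var + K)%type} & form K.

Arguments Atom {K n} i _.

HB.instance Definition _ (K : choiceType) := gen_eqMixin (form K).

Definition folp : Type := form void.

Section Syntax.
Variable K : choiceType.
Implicit Types (A B : form K) (s : seq (Var + K)) (x y : Var).

Definition vars_in s : {fset Var} :=
  [fset x in pmap (fun i => if i is inl x then Some x else None) s].

Definition consts_in s : {fset K} :=
  [fset a in pmap (fun i => if i is inr a then Some a else None) s].

Definition vset (X : {fset Var}) : {fset (Var + K)%type} :=
  [fset (inl x : Var + K) | x in X].

Definition kset (X : {fset K}) : {fset (Var + K)%type} :=
  [fset (inr a : Var + K) | a in X].

Fixpoint FVar A : {fset Var} :=
  match A with
  | Atom _ _ v => vars_in v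
  | Neg B => FVar B
  | Imp B C => FVar B `|` FVar C
  | All x B | Ex x B => FVar B `\ x
  | Just _ X _ => vars_in X
  end.

(* K(A) *)
Fixpoint consts A : {fset K} :=
  match A with
  | Atom _ _ v => consts_in v
  | Neg B | All _ B | Ex _ B => consts B
  | Imp B C => consts B `|` consts C
  | Just _ X B => consts_in X `|` consts B
  end.

Definition sub_ind x (d i : Var + K) : Var + K := if i == inl x then d else i.

(* Replaces the free occurrences of [x] by [d]; no renaming takes place, so for
   [d = inl y] it is meant to be used together with [free_for] below. *)
Fixpoint subst x (d : Var + K) A : form K :=
  match A with
  | Atom _ i v => Atom i (map_tuple (sub_ind x d) v)
  | Neg B => Neg (subst x d B)
  | Imp B C => Imp (subst x d B) (subst x d C)
  | All y B => All y (if y == x then B else subst x d B)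
  | Ex y B => Ex y (if y == x then B else subst x d B)
  | Just t X B =>
      if inl x \in X
      then Just t [fset sub_ind x d i | i in X] (subst x d B)
      else Just t X B
  end.

(* [y] may be substituted for [x] in [A] without changing which occurrences are
   bound.  In t:_X B the free variables of B outside X are bound, so putting a
   new [y] into X must not free occurrences of [y] in B. *)
Fixpoint free_for y x A : Prop :=
  match A with
  | Atom _ _ _ => True
  | Neg B => free_for y x B
  | Imp B C => free_for y x B /\ free_for y x C
  | All z B | Ex z B => x \in FVar B `\ z -> z != y /\ free_for y x B
  | Just _ X B =>
      inl x \in X -> (inl y \in X \/ y \notin FVar B) /\ free_for y x B
  end.

Definition uclos A : form K := foldr (@All K) A (FVar A).

Definition map_ind (L : choiceType) (f : K -> L) (i : Var + K) : Var + L :=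
  match i with inl x => inl x | inr a => inr (f a) end.

Fixpoint map_form (L : choiceType) (f : K -> L) A : form L :=
  match A with
  | Atom _ i v => Atom i (map_tuple (map_ind f) v)
  | Neg B => Neg (map_form f B)
  | Imp B C => Imp (map_form f B) (map_form f C)
  | All y B => All y (map_form f B)
  | Ex y B => Ex y (map_form f B)
  | Just t X B => Just t [fset map_ind f i | i in X] (map_form f B)
  end.

End Syntax.

Arguments vset {K} X.
Arguments kset {K} X.

Definition emb (K : choiceType) (A : folp) : form K := map_form (of_void K) A.

Inductive kform (K : choiceType) : form K -> Prop :=
  | kform_emb (A : folp) : kform (emb K A)
  | kform_subst x (a : K) (A : form K) :
      kform A -> kform (subst x (inr a) A).

Definition closed_form (K : choiceType) (A : form K) : Prop :=
  FVar A = fset0.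

Definition closed_kform (K : choiceType) (A : form K) : Prop :=
  kform A /\ closed_form A.

(* A Hilbert axiomatization of first order logic, to be used with modus ponens
   and generalization. *)
Inductive fol_axiom : folp -> Prop :=
  | ax_K A B : fol_axiom (Imp A (Imp B A))
  | ax_S A B C :
      fol_axiom (Imp (Imp A (Imp B C)) (Imp (Imp A B) (Imp A C)))
  | ax_contra A B : fol_axiom (Imp (Imp (Neg A) (Neg B)) (Imp B A))
  | ax_all_elim x y A : free_for y x A ->
      fol_axiom (Imp (All x A) (subst x (inl y) A))
  | ax_all_imp x A B : x \notin FVar A ->
      fol_axiom (Imp (All x (Imp A B)) (Imp A (All x B)))
  | ax_ex_intro x y A : free_for y x A ->
      fol_axiom (Imp (subst x (inl y) A) (Ex x A))
  | ax_ex_imp x A B : x \notin FVar B ->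
      fol_axiom (Imp (All x (Imp A B)) (Imp (Ex x A) B)).

Inductive folp_axiom : folp -> Prop :=
  | ax_fol A : fol_axiom A -> folp_axiom A
  | ax_ctr t X y A : y \notin X -> y \notin FVar A ->
      folp_axiom (Imp (Just t (vset (y |` X)) A) (Just t (vset X) A))
  | ax_exp t X y A : y \notin X ->
      folp_axiom (Imp (Just t (vset X) A) (Just t (vset (y |` X)) A))
  | ax_suml s t X A :
      folp_axiom (Imp (Just s (vset X) A) (Just (TSum s t) (vset X) A))
  | ax_sumr s t X A :
      folp_axiom (Imp (Just s (vset X) A) (Just (TSum t s) (vset X) A))
  | ax_app s t X A B :
      folp_axiom (Imp (Just s (vset X) (Imp A B))
                   (Imp (Just t (vset X) A) (Just (TApp s t) (vset X) B)))
  | ax_refl t X A : folp_axiom (Imp (Just t (vset X) A) A)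
  | ax_bang t X A :
      folp_axiom (Imp (Just t (vset X) A)
                   (Just (TBang t) (vset X) (Just t (vset X) A)))
  | ax_gen t X x A : x \notin X ->
      folp_axiom (Imp (Just t (vset X) A)
                   (Just (TGen x t) (vset X) (All x A))).

Definition constant_specification (CS : folp -> Prop) : Prop :=
  forall F, CS F ->
    exists c A, F = Just (TCst c) fset0 A /\ folp_axiom A.

(* The domain is an arbitrary nonempty type; [{classic dom}] is the same type
   with the choice structure needed to form finite sets of its elements. *)
Record model (CS : folp -> Prop) : Type := Model {
  dom : Type;
  dom_inhabited : inhabited dom;
  interp : forall n : nat, nat -> n.-tuple dom -> Prop;
  evid : term -> form {classic dom} -> Prop;
  evid_kform : forall t A, evid t A -> kform A;
  evid_cst : forall c A,
    CS (Just (TCst c) fset0 A) -> evid (TCst c) (emb {classic dom} A);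
  evid_app : forall s t A B,
    evid s (Imp A B) -> evid t A -> evid (TApp s t) B;
  evid_sum : forall s t A, evid s A \/ evid t A -> evid (TSum s t) A;
  evid_bang : forall t A (X : {fset {classic dom}}),
    evid t A -> consts A `<=` X -> evid (TBang t) (Just t (kset X) A);
  evid_gen : forall t x A, evid t A -> evid (TGen x t) (All x A);
  evid_inst : forall t x A (a : {classic dom}),
    evid t A -> evid t (subst x (inr a) A)
}.

Section Truth.
Variables (CS : folp -> Prop) (M : model CS).
Let D : choiceType := {classic dom M}.
Implicit Types (A B : form D) (k : nat).

(* Truth is defined by recursion on [rank], which bounds the depth of the
   unfolding; the clauses are [truth_Atom] to [truth_Just] below. *)
Fixpoint rank A : nat :=
  match A with
  | Atom _ _ _ => 1
  | Neg B | All _ B | Ex _ B => (rank B).+1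
  | Imp B C => (maxn (rank B) (rank C)).+1
  | Just _ _ B => (rank B + #|` FVar B|)%N.+1
  end.

Fixpoint truth_upto k A : Prop :=
  if k is k'.+1 then
    match A with
    | Atom n i v =>
        exists2 w : n.-tuple (dom M),
          v = map_tuple (fun a => inr a) w & @interp _ M n i w
    | Neg B => ~ truth_upto k' B
    | Imp B C => truth_upto k' B -> truth_upto k' C
    | All x B => forall a : D, truth_upto k' (subst x (inr a) B)
    | Ex x B => exists a : D, truth_upto k' (subst x (inr a) B)
    | Just t _ B => evid t B /\ truth_upto k' (uclos B)
    end
  else False.

Definition truth A : Prop := truth_upto (rank A) A.

Lemma vars_inP (s : seq (Var + D)) x : (x \in vars_in s) = (inl x \in s).
Proof.
rewrite /vars_in in_fset /=.
by elim: s => [|[y|a] s IH] //=; rewrite !inE IH.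
Qed.

Lemma FVar_subst x (a : D) A : FVar (subst x (inr a) A) `<=` FVar A.
Proof.
elim: A => [n i v|B IH|B IHB C IHC|y B IH|y B IH|t X B IH] /=.
- apply/fsubsetP => z; rewrite !vars_inP => /mapP[j jv].
  by rewrite /sub_ind; case: ifP => // _ ->.
- exact: IH.
- exact: fsetUSS.
- by case: ifP => // _; apply: fsetSD.
- by case: ifP => // _; apply: fsetSD.
- case: ifP => //= _; apply/fsubsetP => z; rewrite !vars_inP.
  by case/imfsetP => j /= jX; rewrite /sub_ind; case: ifP => // _ ->.
Qed.

Lemma rank_subst x (a : D) A : rank (subst x (inr a) A) <= rank A.
Proof.
elim: A => [n i v|B IH|B IHB C IHC|y B IH|y B IH|t X B IH] //=.
- by rewrite ltnS geq_max !leq_max IHB IHC orbT.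
- by case: ifP.
- by case: ifP.
- case: ifP => //= _; rewrite ltnS leq_add //.
  exact: fsubset_leq_card (FVar_subst x a B).
Qed.

Lemma rank_uclos A : rank (uclos A) = (rank A + #|` FVar A|)%N.
Proof.
by rewrite /uclos; elim: (enum_fset _) => [|y s IH] /=; rewrite ?addn0 // IH addnS.
Qed.

Lemma truth_uptoE k l A :
  rank A <= k -> rank A <= l -> truth_upto k A <-> truth_upto l A.
Proof.
elim: k l A => [|k IH] [|l] [n i v|B|B C|y B|y B|t X B] //=; rewrite ?ltnS.
- by move=> hk hl; have := IH l B hk hl; tauto.
- rewrite !geq_max => /andP[kB kC] /andP[lB lC].
  by have := IH l B kB lB; have := IH l C kC lC; tauto.
- move=> hk hl; have E a : truth_upto k (subst y (inr a) B) <->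
      truth_upto l (subst y (inr a) B).
    by apply: IH; apply: leq_trans (rank_subst y a B) _.
  by split=> H a; apply/E.
- move=> hk hl; have E a : truth_upto k (subst y (inr a) B) <->
      truth_upto l (subst y (inr a) B).
    by apply: IH; apply: leq_trans (rank_subst y a B) _.
  by split=> -[a H]; exists a; apply/E.
- rewrite -rank_uclos => hk hl.
  by have := IH l (uclos B) hk hl; tauto.
Qed.

Lemma truth_Atom n i (w : n.-tuple (dom M)) :
  truth (Atom i (map_tuple (fun a : D => inr a) w)) <-> @interp _ M n i w.
Proof.
split=> [[w' e]|]; last by exists w.
suff -> : w = w' by [].
apply/val_inj => /=; move/(congr1 val): e => /= /inj_map; apply.
by move=> a b [].
Qed.

Lemma truth_Neg A : truth (Neg A) <-> ~ truth A.
Proof. by []. Qed.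

Lemma truth_Imp A B : truth (Imp A B) <-> (truth A -> truth B).
Proof.
rewrite /truth /=.
have := @truth_uptoE (maxn (rank A) (rank B)) (rank A) A (leq_maxl _ _) (leqnn _).
have := @truth_uptoE (maxn (rank A) (rank B)) (rank B) B (leq_maxr _ _) (leqnn _).
tauto.
Qed.

Lemma truth_All x A :
  truth (All x A) <-> forall a : D, truth (subst x (inr a) A).
Proof.
have E a := @truth_uptoE (rank A) _ (subst x (inr a) A) (rank_subst x a A) (leqnn _).
by split=> H a; [apply: (E a).1 | apply: (E a).2]; apply: H.
Qed.

Lemma truth_Ex x A :
  truth (Ex x A) <-> exists a : D, truth (subst x (inr a) A).
Proof.
have E a := @truth_uptoE (rank A) _ (subst x (inr a) A) (rank_subst x a A) (leqnn _).
by split=> -[a H]; exists a; [apply: (E a).1 | apply: (E a).2].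
Qed.

Lemma truth_Just t X A : truth (Just t X A) <-> evid t A /\ truth (uclos A).
Proof. by rewrite /truth rank_uclos. Qed.

End Truth.

Arguments truth {CS} M A.

Definition valid (CS : folp -> Prop) (A : folp) : Prop :=
  forall M : model CS, truth M (emb {classic dom M} A).

Notation Par := nat (only parsing).

Notation branch := (seq (form Par)) (only parsing).

Definition new_on (b : branch) (u : Par) : Prop :=
  forall A, A \in b -> u \notin consts A.

(* [rule b P C]: a rule with premise [P] is applicable on the branch [b], and
   [C] lists the alternative groups of formulas by which [b] is extended. *)
Inductive rule (b : branch) : form Par -> seq (seq (form Par)) -> Prop :=
  | FNeg A : rule b (Neg (Neg A)) [:: [:: A]]
  | TImp A B : rule b (Imp A B) [:: [:: Neg A]; [:: B]]
  | FImp A B : rule b (Neg (Imp A B)) [:: [:: A; Neg B]]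
  | TAll x A (u : Par) : rule b (All x A) [:: [:: subst x (inr u) A]]
  | FEx x A (u : Par) :
      rule b (Neg (Ex x A)) [:: [:: Neg (subst x (inr u) A)]]
  | TEx x A (u : Par) : new_on b u ->
      rule b (Ex x A) [:: [:: subst x (inr u) A]]
  | FAll x A (u : Par) : new_on b u ->
      rule b (Neg (All x A)) [:: [:: Neg (subst x (inr u) A)]]
  | TJust t (X : {fset Par}) A :
      rule b (Just t (kset X) A) [:: [:: uclos A]]
  | FSum t s (X : {fset Par}) A :
      rule b (Neg (Just (TSum t s) (kset X) A))
        [:: [:: Neg (Just t (kset X) A); Neg (Just s (kset X) A)]]
  | FApp s t (X : {fset Par}) A B : kform A -> consts A `<=` X ->
      rule b (Neg (Just (TApp s t) (kset X) B))
        [:: [:: Neg (Just s (kset X) (Imp A B))];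
            [:: Neg (Just t (kset X) A)]]
  | FBang t (X : {fset Par}) A :
      rule b (Neg (Just (TBang t) (kset X) (Just t (kset X) A)))
        [:: [:: Neg (Just t (kset X) A)]]
  | Ctr t (X : {fset Par}) (u : Par) A : u \notin X ->
      rule b (Neg (Just t (kset X) A))
        [:: [:: Neg (Just t (kset (u |` X)) A)]]
  | Exp t (X : {fset Par}) (u : Par) A : u \notin X -> u \notin consts A ->
      rule b (Neg (Just t (kset (u |` X)) A))
        [:: [:: Neg (Just t (kset X) A)]]
  | Ins t (X : {fset Par}) x (u : Par) A :
      rule b (Neg (Just t (kset X) (subst x (inr u) A)))
        [:: [:: Neg (Just t (kset X) A)]]
  | GenX x t (X : {fset Par}) A :
      rule b (Neg (Just (TGen x t) (kset X) (All x A)))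
        [:: [:: Neg (Just t (kset X) A)]].

(* A tableau is represented by the list of its branches. *)
Inductive tableau (S : seq (form Par)) : seq (seq (form Par)) -> Prop :=
  | tableau_start :
      (forall A, A \in S -> closed_kform A) -> tableau S [:: S]
  | tableau_extend T1 (b : branch) T2 P C :
      tableau S (T1 ++ b :: T2) -> P \in b -> rule b P C ->
      (forall c A, c \in C -> A \in c -> closed_kform A) ->
      tableau S (T1 ++ [seq b ++ c | c <- C] ++ T2).

Inductive closed_branch (CS : folp -> Prop) (b : branch) : Prop :=
  | closed_contra A : A \in b -> Neg A \in b -> closed_branch CS b
  | closed_CS c A : CS (Just (TCst c) fset0 A) ->
      Neg (emb _ (Just (TCst c) fset0 A)) \in b -> closed_branch CS b.

Definition tableau_provable (CS : folp -> Prop) (F : folp) : Prop :=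
  exists2 T, tableau [:: Neg (emb _ F)] T &
    forall b, b \in T -> closed_branch CS b.

(* Main.v *)
Require Import Defs.
From mathcomp Require Import all_boot finmap boolp.

(* By truth_uclos, t:_X A holds iff A is in the evidence set of t and every
   instance of A holds, so the truth of t:_X A does not depend on X.  Hence all
   instances of the axioms hold, and interpreting the parameters in the domain,
   every tableau rule keeps some branch satisfied; a closed branch never is.
   The one rule that looks at X is (F!): it relies on the fact that in a
   K-formula every subformula t:_X A satisfies K(A) <= X. *)

Set Implicit Arguments.
Unset Strict Implicit.
Unset Printing Implicit Defensive.

Local Open Scope fset_scope.

(** * Simultaneous instantiation of variables by members of [K] *)

Lemma in_vars_in (K : choiceType) (s : seq (nat + K)) x :
  (x \in vars_in s) = (inl x \in s).
Proof.
rewrite /vars_in in_fset /=.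
by elim: s => [|[y|a] s IH] //=; rewrite !inE IH.
Qed.

Lemma in_consts_in (K : choiceType) (s : seq (nat + K)) a :
  (a \in consts_in s) = (inr a \in s).
Proof.
rewrite /consts_in in_fset /=.
by elim: s => [|[y|b] s IH] //=; rewrite !inE IH.
Qed.

Definition inst_ind (K : choiceType) (f : nat -> option K) (i : nat + K) :
    nat + K :=
  match i with
  | inl x => if f x is Some a then inr a else inl x
  | inr a => inr a
  end.

Definition upd (K : choiceType) (f : nat -> option K) x o :=
  fun y => if y == x then o else f y.

(** Inside t:_X B the variables outside [X] count as bound, so an instantiation entering B must be
    cut down to [X]. *)
Definition restr (K : choiceType) (f : nat -> option K)
    (X : {fset (nat + K)%type}) :=
  fun x => if inl x \in X then f x else None.

Definition orelse (K : choiceType) (f g : nat -> option K) :=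
  fun x => if f x is Some a then Some a else g x.

(* Simultaneous substitution of members of [K] for the free occurrences of the
   variables at which [f] is defined. *)
Fixpoint inst (K : choiceType) (f : nat -> option K) (A : form K) : form K :=
  match A with
  | Atom _ i v => Atom i (map_tuple (inst_ind f) v)
  | Neg B => Neg (inst f B)
  | Imp B C => Imp (inst f B) (inst f C)
  | All y B => All y (inst (upd f y None) B)
  | Ex y B => Ex y (inst (upd f y None) B)
  | Just t X B => Just t [fset inst_ind f i | i in X] (inst (restr f X) B)
  end.

Lemma inst_ext (K : choiceType) (A : form K) f g :
  {in FVar A, f =1 g} -> inst f A = inst g A.
Proof.
elim: A f g => [n i v|B IH|B IHB C IHC|y B IH|y B IH|t X B IH] f g /= fg.
- congr Atom; apply: val_inj => /=; apply/eq_in_map => -[x|a] //= xv.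
  by rewrite fg // in_vars_in.
- by rewrite (IH f g).
- by rewrite (IHB f g) ?(IHC f g) // => x xB; apply: fg; rewrite inE xB ?orbT.
- rewrite (IH _ (upd g y None)) // => x xB; rewrite /upd.
  by case: eqP => // /eqP xy; apply: fg; rewrite !inE xy.
- rewrite (IH _ (upd g y None)) // => x xB; rewrite /upd.
  by case: eqP => // /eqP xy; apply: fg; rewrite !inE xy.
- congr Just.
    apply: eq_in_imfset => // -[x|a] //= xX.
    by rewrite fg // in_vars_in.
  apply: IH => x _; rewrite /restr; case: ifP => // xX.
  by rewrite fg // in_vars_in.
Qed.

Lemma inst_none (K : choiceType) (A : form K) : inst (fun=> None) A = A.
Proof.
have idE : inst_ind (fun=> None : option K) =1 id by case.
elim: A => [n i v|B IH|B IHB C IHC|y B IH|y B IH|t X B IH] /=.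
- by congr Atom; apply: val_inj; rewrite /= (eq_map idE) map_id.
- by rewrite IH.
- by rewrite IHB IHC.
- by rewrite -[RHS]/(All y B) -{2}IH; congr All; apply: inst_ext => x _; rewrite /upd if_same.
- by rewrite -[RHS]/(Ex y B) -{2}IH; congr Ex; apply: inst_ext => x _; rewrite /upd if_same.
- congr Just.
    by apply/fsetP => i; rewrite (eq_in_imfset _ (in1W idE)) imfset_id.
  by rewrite -{2}IH; apply: inst_ext => x _; rewrite /restr if_same.
Qed.

Lemma inst_ind_comp (K : choiceType) (f g : nat -> option K) :
  inst_ind g \o inst_ind f =1 inst_ind (orelse f g).
Proof. by case=> [x|a] //=; rewrite /orelse; case: (f x). Qed.

Lemma inl_inst_ind (K : choiceType) (f : nat -> option K)
    (X : {fset (nat + K)%type}) x :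
  (inl x \in [fset inst_ind f i | i in X]) = (inl x \in X) && (f x == None).
Proof.
apply/imfsetP/andP => [[[y|a] //= yX]|[xX /eqP fx]].
  by case fy: (f y) => // -[->]; rewrite yX fy.
by exists (inl x); rewrite //= fx.
Qed.

(** Members of [K] are never captured, so composition is pointwise, and the first map has priority
    because what it replaces is no longer a variable. In the [Just] case the variables left in the
    new index set are those of [X] where [f] is undefined, exactly where [g] may still act. *)
Lemma inst_comp (K : choiceType) (A : form K) f g :
  inst g (inst f A) = inst (orelse f g) A.
Proof.
elim: A f g => [n i v|B IH|B IHB C IHC|y B IH|y B IH|t X B IH] f g /=.
- congr Atom; apply: val_inj; rewrite /= -map_comp.
  exact/eq_map/inst_ind_comp.
- by rewrite IH.
- by rewrite IHB IHC.
- by rewrite IH; congr All; apply: inst_ext => x _; rewrite /orelse /upd; case: eqP.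
- by rewrite IH; congr Ex; apply: inst_ext => x _; rewrite /orelse /upd; case: eqP.
- congr Just.
    by rewrite -imfset_comp (eq_in_imfset _ (in1W (inst_ind_comp f g))).
  rewrite IH; apply: inst_ext => x _; rewrite /orelse /restr inl_inst_ind.
  by case: (inl x \in X) => //=; case: (f x).
Qed.

(** Through this bridge, identities about substituting members of [K] reduce to comparing partial
    maps pointwise, by [inst_comp] and [inst_ext]. *)
Lemma subst_inst (K : choiceType) x (a : K) A :
  subst x (inr a) A = inst (upd (fun=> None) x (Some a)) A.
Proof.
have subE : sub_ind x (inr a : nat + K) =1
    inst_ind (upd (fun=> None) x (Some a)).
  by case=> [y|b] //=; rewrite /sub_ind /upd /eq_op /= -/(eq_op y x); case: eqP.
elim: A => [n i v|B IH|B IHB C IHC|y B IH|y B IH|t X B IH] /=.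
- by congr Atom; apply: val_inj; apply: eq_map.
- by rewrite IH.
- by rewrite IHB IHC.
- congr All; case: eqP => [->|/eqP yx].
    by rewrite -[LHS]inst_none; apply: inst_ext => z _; rewrite /upd; case: eqP.
  rewrite IH; apply: inst_ext => z _; rewrite /upd; case: (z =P y) => // ->.
  by rewrite (negbTE yx).
- congr Ex; case: eqP => [->|/eqP yx].
    by rewrite -[LHS]inst_none; apply: inst_ext => z _; rewrite /upd; case: eqP.
  rewrite IH; apply: inst_ext => z _; rewrite /upd; case: (z =P y) => // ->.
  by rewrite (negbTE yx).
- case: ifP => xX.
    rewrite (eq_in_imfset _ (in1W subE)) IH; congr Just.
    apply: inst_ext => z _; rewrite /restr /upd.
    by case: eqP => [->|]; rewrite ?xX ?if_same.
  (* If [x] is outside [X], [subst] stops at the justification formula, and the restricted map is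
     nowhere defined, so [inst] changes nothing either. *)
  have N : restr (upd (fun=> None) x (Some a)) X =1 fun=> None.
    by move=> z; rewrite /restr /upd; case: ifP => //; case: eqP => // ->; rewrite xX.
  rewrite (@inst_ext _ B _ (fun=> None)) ?inst_none => [|z _]; last exact: N.
  congr Just; apply/fsetP => i; rewrite -[in LHS](imfset_id X).
  congr (i \in _); apply: eq_in_imfset => // -[z|b] //= zX.
  by have := N z; rewrite /restr zX => ->.
Qed.

Lemma inst_subst (K : choiceType) x (a : K) f A :
  inst f (subst x (inr a) A) = inst (upd f x (Some a)) A.
Proof.
rewrite subst_inst inst_comp; apply: inst_ext => z _.
by rewrite /orelse /upd; case: eqP.
Qed.

(** The quantifier clauses of truth meet this shape: [inst] protects the bound variable, and the
    truth clause then gives it a value. *)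
Lemma subst_inst_upd (K : choiceType) x (a : K) f A :
  subst x (inr a) (inst (upd f x None) A) = inst (upd f x (Some a)) A.
Proof.
rewrite subst_inst inst_comp; apply: inst_ext => z _.
by rewrite /orelse /upd; case: eqP => // _; case: (f z).
Qed.

Lemma subst_notin (K : choiceType) x d (A : form K) :
  x \notin FVar A -> subst x d A = A.
Proof.
elim: A => [n i v|B IH|B IHB C IHC|y B IH|y B IH|t X B IH] /= xA.
- congr Atom; apply: val_inj; rewrite /= -[RHS]map_id.
  apply/eq_in_map => j jv; rewrite /sub_ind; case: eqP => // ej.
  by move: xA; rewrite in_vars_in -ej jv.
- by rewrite IH.
- by move: xA; rewrite inE negb_or => /andP[xB xC]; rewrite IHB ?IHC.
- case: eqP => // /eqP; move: xA; rewrite !inE eq_sym.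
  by move=> /nandP[/negPn->//|xB] _; rewrite IH.
- case: eqP => // /eqP; move: xA; rewrite !inE eq_sym.
  by move=> /nandP[/negPn->//|xB] _; rewrite IH.
- by move: xA; rewrite in_vars_in => /negbTE->.
Qed.

(** By [free_for], every [y] put in place of [x] is still free, so the later instantiation reaches
    it and gives it the value [a]; no other occurrence of [y] changes status. *)
Lemma inst_subst_var (K : choiceType) x y (a : K) f A :
  free_for y x A -> f y = Some a ->
  inst f (subst x (inl y) A) = inst (upd f x (Some a)) A.
Proof.
have indE g i : g y = Some a -> inst_ind g (sub_ind x (inl y : nat + K) i) =
    inst_ind (upd g x (Some a)) i.
  move=> gy; case: i => [z|b] //=.
  rewrite /sub_ind /upd /eq_op /= -/(eq_op z x).
  by case: eqP => //= _; rewrite gy.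
(* The argument shared by the two quantifiers. *)
have Q z (B : form K) g : (forall g, free_for y x B -> g y = Some a ->
      inst g (subst x (inl y) B) = inst (upd g x (Some a)) B) ->
    (x \in FVar B `\ z -> z != y /\ free_for y x B) -> g y = Some a ->
    inst (upd g z None) (if z == x then B else subst x (inl y) B) =
    inst (upd (upd g x (Some a)) z None) B.
  move=> IH fz gy; case: eqP => [->|/eqP zx].
    by apply: inst_ext => w _; rewrite /upd; case: eqP.
  have [xB|xB] := boolP (x \in FVar B).
    have [|zy ff] := fz; first by rewrite !inE eq_sym zx.
    rewrite IH //; last by rewrite /upd eq_sym (negbTE zy).
    apply: inst_ext => w _; rewrite /upd; case: (w =P x) => // ->.
    by rewrite eq_sym (negbTE zx).
  rewrite subst_notin //; apply: inst_ext => w wB; rewrite /upd.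
  by case: (w =P x) wB => // ->; rewrite (negbTE xB).
elim: A f => [n i v|B IH|B IHB C IHC|z B IH|z B IH|t X B IH] f /=.
- move=> _ fy; congr Atom; apply: val_inj; rewrite /= -map_comp.
  by apply: eq_map => j /=; rewrite indE.
- by move=> ff fy; rewrite IH.
- by move=> [fB fC] fy; rewrite IHB ?IHC.
- by move=> ff fy; rewrite Q.
- by move=> ff fy; rewrite Q.
- move=> ff fy; case: ifP => xX /=; last first.
    have E w : inl w \in X -> upd f x (Some a) w = f w.
      by rewrite /upd; case: eqP => // ->; rewrite xX.
    congr Just.
      by apply: eq_in_imfset => // -[w|b] //= wX; rewrite E.
    by apply: inst_ext => w _; rewrite /restr; case: ifP => // /E.
  have [yB ffB] := ff xX; congr Just.
    rewrite -imfset_comp; apply: eq_in_imfset => // i _ /=; exact: indE.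
  have yX : inl y \in [fset sub_ind x (inl y) i | i in X].
    by apply/imfsetP; exists (inl x); rewrite //= /sub_ind eqxx.
  rewrite IH //; last by rewrite /restr yX.
  apply: inst_ext => w wB; rewrite /restr /upd.
  case: (w =P x) => [->|wx]; first by rewrite xX.
  (* The delicate variable is [y], which the substitution puts into the index set. Either it was in
     [X] before, or it is not free in B and the two maps need not agree on it. *)
  have [wy|wy] := eqVneq w y.
    by rewrite wy in wB *; case: yB => [->|]; rewrite ?yX ?wB.
  suff -> : (inl w \in [fset sub_ind x (inl y) i | i in X]) = (inl w \in X) by [].
  apply/imfsetP/idP => [[i /= iX]|wX].
    by rewrite /sub_ind; case: eqP => [_ [] /eqP|_ ->]; rewrite ?(negbTE wy).
  exists (inl w) => //=; rewrite /sub_ind /eq_op /= -/(eq_op w x).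
  by case: eqP wx.
Qed.

(** * Renaming the members of [K] along a map *)

Lemma FVar_map (K L : choiceType) (h : K -> L) A : FVar (map_form h A) = FVar A.
Proof.
elim: A => [n i v|B IH|B IHB C IHC|y B IH|y B IH|t X B IH] //=;
  rewrite ?IH ?IHB ?IHC //; apply/fsetP => x; rewrite !in_vars_in.
  apply/mapP/idP => [[[y|b] yv //= [->]] //|xv]; by exists (inl x).
by apply/imfsetP/idP => [[[y|b] /= yv //= [->]] //|xv]; exists (inl x).
Qed.

Lemma map_uclos (K L : choiceType) (h : K -> L) A :
  map_form h (uclos A) = uclos (map_form h A).
Proof.
by rewrite /uclos FVar_map; elim: (enum_fset _) => //= x s ->.
Qed.

Lemma inl_map_ind (K L : choiceType) (h : K -> L) (X : {fset (nat + K)%type}) x :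
  (inl x \in [fset map_ind h i | i in X]) = (inl x \in X).
Proof.
by apply/imfsetP/idP => [[[y|b] /= yX //= [->]] //|xX]; exists (inl x).
Qed.

Lemma map_subst (K L : choiceType) (h : K -> L) x d A :
  map_form h (subst x d A) = subst x (map_ind h d) (map_form h A).
Proof.
have indE i : map_ind h (sub_ind x d i) =
    sub_ind x (map_ind h d) (map_ind h i).
  case: i => [y|b] //=.
  by rewrite /sub_ind /eq_op /= -/(eq_op y x); case: eqP.
elim: A => [n i v|B IH|B IHB C IHC|y B IH|y B IH|t X B IH] /=.
- congr Atom; apply: val_inj; rewrite /= -!map_comp.
  by apply: eq_map => j /=; rewrite indE.
- by rewrite IH.
- by rewrite IHB IHC.
- by rewrite -IH; case: ifP.
- by rewrite -IH; case: ifP.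
- rewrite inl_map_ind; case: ifP => //= _; rewrite IH; congr Just.
  rewrite -!imfset_comp; apply: eq_in_imfset => // i _; exact: indE.
Qed.

Lemma map_comp_form (K L N : choiceType) (h : K -> L) (g : L -> N) A :
  map_form g (map_form h A) = map_form (g \o h) A.
Proof.
have indE : map_ind g \o map_ind h =1 map_ind (g \o h) by case.
elim: A => [n i v|B IH|B IHB C IHC|y B IH|y B IH|t X B IH] /=;
  rewrite ?IH ?IHB ?IHC //.
  by congr Atom; apply: val_inj; rewrite /= -map_comp; apply: eq_map.
by rewrite -imfset_comp (eq_in_imfset _ (in1W indE)).
Qed.

Lemma map_form_ext (K L : choiceType) (h g : K -> L) A :
  {in consts A, h =1 g} -> map_form h A = map_form g A.
Proof.
elim: A => [n i v|B IH|B IHB C IHC|y B IH|y B IH|t X B IH] /= hg;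
  rewrite ?IH //.
- congr Atom; apply: val_inj; apply/eq_in_map => -[x|a] //= av.
  by rewrite hg // in_consts_in.
- by rewrite IHB ?IHC // => a aB; apply: hg; rewrite inE aB ?orbT.
- congr Just; apply: eq_in_imfset => // -[x|a] //= aX.
  by rewrite hg // inE in_consts_in aX.
- by move=> a aB; apply: hg; rewrite inE aB orbT.
Qed.

Lemma map_emb (K L : choiceType) (h : K -> L) A :
  map_form h (emb K A) = emb L A.
Proof. by rewrite /emb map_comp_form; apply: map_form_ext => -[]. Qed.

Lemma map_kset (K L : choiceType) (h : K -> L) (X : {fset K}) :
  [fset map_ind h i | i in kset X] = kset [fset h a | a in X].
Proof.
rewrite /kset -!imfset_comp; exact: eq_in_imfset.
Qed.

Lemma consts_map (K L : choiceType) (h : K -> L) A :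
  consts (map_form h A) = [fset h a | a in consts A].
Proof.
elim: A => [n i v|B IH|B IHB C IHC|y B IH|y B IH|t X B IH] //=.
- apply/fsetP => a; rewrite in_consts_in /=.
  apply/mapP/imfsetP => /= [[[y|b] bv //= [->]]|[b]].
    by exists b; rewrite ?in_consts_in.
  by rewrite in_consts_in => bv ->; exists (inr b).
- by rewrite imfsetU IHB IHC.
- rewrite imfsetU IH; congr (_ `|` _).
  apply/fsetP => a; rewrite in_consts_in /=.
  apply/imfsetP/imfsetP => /= [[[y|b] /= bv //= [->]]|[b]].
    by exists b; rewrite ?in_consts_in.
  by rewrite in_consts_in => bv ->; exists (inr b).
Qed.

Lemma free_for_map (K L : choiceType) (h : K -> L) y x A :
  free_for y x A -> free_for y x (map_form h A).
Proof.
elim: A => [n i v|B IH|B IHB C IHC|z B IH|z B IH|t X B IH] //=.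
- by case=> /IHB ? /IHC.
- by move=> ff; rewrite FVar_map => /ff[-> /IH].
- by move=> ff; rewrite FVar_map => /ff[-> /IH].
- by rewrite FVar_map !inl_map_ind => ff /ff[? /IH].
Qed.

Lemma map_vset (K L : choiceType) (h : K -> L) (X : {fset nat}) :
  [fset map_ind h i | i in vset X] = vset X.
Proof. by rewrite /vset -imfset_comp; apply: eq_in_imfset. Qed.

Lemma in_vset (K : choiceType) (X : {fset nat}) x :
  ((inl x : nat + K) \in vset X) = (x \in X).
Proof.
by apply/imfsetP/idP => [[y /= yX [->]] //|xX]; exists x.
Qed.

(** * Members of [K] occurring in a [K]-formula *)

Lemma consts_emb (K : choiceType) A : consts (emb K A) = fset0.
Proof.
by rewrite /emb consts_map; apply/fsetP => a; rewrite inE; apply/imfsetP => -[[]].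
Qed.

Lemma consts_inst (K : choiceType) (f : nat -> option K) A a :
  a \in consts (inst f A) ->
  a \in consts A \/ exists2 x, x \in FVar A & f x = Some a.
Proof.
have indE (X : seq (nat + K)) g i : i \in X -> inr a = inst_ind g i ->
    inr a \in X \/ exists2 x, inl x \in X & g x = Some a.
  case: i => [x|b] /= iX.
    by case gx: (g x) => [b|] // [->]; right; exists x.
  by case=> ->; left.
elim: A f => [n i v|B IH|B IHB C IHC|z B IH|z B IH|t X B IH] f /=.
- rewrite !in_consts_in => /mapP[j jv /(indE _ _ _ jv)[|[x xv fx]]]; first by left.
  by right; exists x; rewrite ?in_vars_in.
- exact: IH.
- rewrite !inE => /orP[/IHB|/IHC] [->|[x xB fx]]; rewrite ?orbT; try by left.
    by right; exists x; rewrite // inE xB.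
  by right; exists x; rewrite // inE xB orbT.
- move=> /IH[|[x xB]]; first by left.
  by rewrite /upd; case: eqP => // /eqP xz fx; right; exists x; rewrite // !inE xz.
- move=> /IH[|[x xB]]; first by left.
  by rewrite /upd; case: eqP => // /eqP xz fx; right; exists x; rewrite // !inE xz.
- rewrite !in_fsetU !in_consts_in => /orP[/imfsetP[j /= jX /(indE _ _ _ jX)[->|[x xX fx]]]|].
  + by left.
  + by right; exists x; rewrite ?in_vars_in.
  + move=> /IH[->|[x xB]]; first by rewrite orbT; left.
    by rewrite /restr; case: ifP => // xX fx; right; exists x; rewrite ?in_vars_in.
Qed.

(** An invariant of [K]-formulas that can be read off the syntax tree; it fails, for instance, for
    t:_{} Q(a). *)
Fixpoint Just_consts (K : choiceType) (A : form K) : bool :=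
  match A with
  | Atom _ _ _ => true
  | Neg B | All _ B | Ex _ B => Just_consts B
  | Imp B C => Just_consts B && Just_consts C
  | Just _ X B => (consts B `<=` consts_in X) && Just_consts B
  end.

Lemma consts_subst (K : choiceType) x (a : K) A b :
  b \in consts (subst x (inr a) A) -> b \in consts A \/ b = a.
Proof.
rewrite subst_inst => /consts_inst[|[z _]]; first by left.
by rewrite /upd; case: eqP => // _ [->]; right.
Qed.

(** FOLP formulas contain no members of [K]. Substituting [a] for [x] in t:_X B changes B only if
    [x] is in [X], and then [a] enters the index set together with B. *)
Lemma Just_consts_kform (K : choiceType) (A : form K) :
  kform A -> Just_consts A.
Proof.
elim=> {A} [A|x a A _].
  rewrite /emb.
  elim: A => [n i v|B IH|B IHB C IHC|z B IH|z B IH|t X B IH] //=.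
    by rewrite IHB IHC.
  by rewrite IH andbT -/(emb K B) consts_emb fsub0set.
elim: A => [n i v|B IH|B IHB C IHC|z B IH|z B IH|t X B IH] //=.
- by move=> /andP[/IHB-> /IHC->].
- by case: ifP.
- by case: ifP.
- move=> /andP[BX JB]; case: ifP => /= xX; last by rewrite BX.
  rewrite IH // andbT; apply/fsubsetP => b /consts_subst; move/fsubsetP in BX.
  rewrite in_consts_in => -[/BX|->].
    by rewrite in_consts_in => bX; apply/imfsetP; exists (inr b).
  by apply/imfsetP; exists (inl x); rewrite //= /sub_ind eqxx.
Qed.

(** * Truth of universal closures *)

Lemma FVar_subst_notin (K : choiceType) x (a : K) (A : form K) z :
  z \in FVar (subst x (inr a) A) -> (z \in FVar A) && (z != x).
Proof.
elim: A => [n i v|B IH|B IHB C IHC|y B IH|y B IH|t X B IH] //=.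
- rewrite !in_vars_in => /mapP[j jv]; rewrite /sub_ind; case: eqP => // jx ej.
  by rewrite ej jv; apply/eqP => zx; apply: jx; rewrite -ej zx.
- by rewrite !inE => /orP[/IHB|/IHC] /andP[-> ->]; rewrite ?orbT.
- rewrite !inE => /andP[zy]; case: eqP => [yx|_ /IH/andP[-> ->]]; rewrite zy //.
  by move=> ->; rewrite -yx.
- rewrite !inE => /andP[zy]; case: eqP => [yx|_ /IH/andP[-> ->]]; rewrite zy //.
  by move=> ->; rewrite -yx.
- case: ifP => xX /=; rewrite !in_vars_in.
    case/imfsetP => j /= jX; rewrite /sub_ind; case: eqP => // jx ej.
    by rewrite ej jX; apply/eqP => zx; apply: jx; rewrite -ej zx.
  by move=> zX; rewrite zX; apply: contraFN xX => /eqP<-.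
Qed.

Lemma subst_foldr_All (K : choiceType) x d (A : form K) s :
  x \notin s ->
  subst x d (foldr (@All K) A s) = foldr (@All K) (subst x d A) s.
Proof.
elim: s => //= y s IH; rewrite inE negb_or eq_sym => /andP[/negbTE-> xs].
by rewrite IH.
Qed.

(** Induction on the prefix, for all formulas at once: the outermost quantifier gives [x] a value,
    and the substituted formula has its free variables in the rest. Absence of repetitions lets the
    substitution pass through the remaining quantifiers. *)
Lemma truth_foldr_All (CS : folp -> Prop) (M : model CS) s
    (A : form {classic dom M}) : {subset FVar A <= s} -> uniq s ->
  truth M (foldr (@All _) A s) <->
  forall f : nat -> {classic dom M}, truth M (inst (fun x => Some (f x)) A).
Proof.
elim: s A => [|x s IH] A /= As.
  have E f : inst (fun x => Some (f x)) A = A.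
    by rewrite -[RHS]inst_none; apply: inst_ext => x /As; rewrite in_nil.
  move=> _; split=> [tA f|]; first by rewrite E.
  (* Nonemptiness of the domain provides an assignment to specialize to. *)
  have [a] := dom_inhabited M.
  by move/(_ (fun=> a)); rewrite E.
move=> /andP[xs us]; rewrite truth_All.
have sub a : {subset FVar (subst x (inr a) A) <= s}.
  by move=> z /FVar_subst_notin/andP[/As]; rewrite inE; case: eqP.
have E f a : inst (fun y => Some (f y)) (subst x (inr a) A) =
    inst (fun y => Some (if y == x then a else f y)) A.
  by rewrite inst_subst; apply: inst_ext => y _; rewrite /upd; case: eqP.
split=> [H f|H a].
  have := H (f x); rewrite subst_foldr_All // => /(IH _ (@sub _) us)/(_ f).
  rewrite E; congr truth; apply: inst_ext => y _.
  by case: eqP => // ->.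
by rewrite subst_foldr_All //; apply/(IH _ (@sub _) us) => f; rewrite E.
Qed.

(** This removes the dependence on the order in which [uclos] enumerates the free variables, which
    instantiation may alter. *)
Lemma truth_uclos (CS : folp -> Prop) (M : model CS)
    (A : form {classic dom M}) :
  truth M (uclos A) <->
  forall f : nat -> {classic dom M}, truth M (inst (fun x => Some (f x)) A).
Proof. by apply: truth_foldr_All => //; apply: fset_uniq. Qed.

(** * Truth of the axioms in a model *)

Section Soundness.
Variables (CS : folp -> Prop) (M : model CS).
Let D : choiceType := {classic dom M}.
Implicit Types (A B : form D) (f : nat -> D).

Definition gtruth A := forall f, truth M (inst (fun x => Some (f x)) A).

Lemma truth_JustE t X A : truth M (Just t X A) <-> evid t A /\ gtruth A.
Proof. by rewrite truth_Just truth_uclos. Qed.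

Lemma truth_inst_All f x A :
  truth M (inst (fun y => Some (f y)) (All x A)) <->
  forall a, truth M (inst (fun y => Some (if y == x then a else f y)) A).
Proof.
have E a : subst x (inr a) (inst (upd (fun y => Some (f y)) x None) A) =
    inst (fun y => Some (if y == x then a else f y)) A.
  by rewrite subst_inst_upd; apply: inst_ext => y _; rewrite /upd; case: eqP.
by rewrite /= truth_All; split=> H a; [rewrite -E|rewrite E]; apply: H.
Qed.

Lemma truth_inst_Ex f x A :
  truth M (inst (fun y => Some (f y)) (Ex x A)) <->
  exists a, truth M (inst (fun y => Some (if y == x then a else f y)) A).
Proof.
have E a : subst x (inr a) (inst (upd (fun y => Some (f y)) x None) A) =
    inst (fun y => Some (if y == x then a else f y)) A.
  by rewrite subst_inst_upd; apply: inst_ext => y _; rewrite /upd; case: eqP.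
by rewrite /= truth_Ex; split=> -[a H]; exists a; [rewrite -E|rewrite E]; apply: H.
Qed.

Lemma gtruth_Imp A B : gtruth (Imp A B) -> gtruth A -> gtruth B.
Proof. by move=> AB tA f; have /truth_Imp := AB f; apply; apply: tA. Qed.

Lemma gtruth_inst g A : gtruth A -> gtruth (inst g A).
Proof.
move=> tA f; rewrite inst_comp.
(* The combined assignment follows [g] where it is defined and [f] elsewhere. *)
have := tA (fun x => odflt (f x) (g x)); congr truth; apply: inst_ext => x _.
by rewrite /orelse; case: (g x).
Qed.

Lemma gtruth_All x A : gtruth A -> gtruth (All x A).
Proof. by move=> tA f; apply/truth_inst_All => a; apply: tA. Qed.

Lemma gtruth_subst x a A : gtruth A -> gtruth (subst x (inr a) A).
Proof. by rewrite subst_inst; apply: gtruth_inst. Qed.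

(** With only domain members in the index set the formula is closed, so assignments do not act on
    it. *)
Lemma gtruth_kset t (X : {fset D}) A :
  gtruth (Just t (kset X) A) <-> truth M (Just t (kset X) A).
Proof.
have E f : inst (fun x => Some (f x)) (Just t (kset X) A) = Just t (kset X) A.
  rewrite -[RHS]inst_none; apply: inst_ext => x; rewrite in_vars_in.
  by case/imfsetP.
split=> [|H f]; last by rewrite E.
have [a] := dom_inhabited M.
by move/(_ (fun=> a)); rewrite E.
Qed.

(** The evidence comes from the closure condition for [TBang], whose side condition is [AX]; the
    closure part is [tA] itself, as t:_X A is closed. Both the axiom and the rule (F!) rest on
    this. *)
Lemma truth_bang t (X : {fset D}) A : consts A `<=` X ->
  truth M (Just t (kset X) A) ->
  truth M (Just (TBang t) (kset X) (Just t (kset X) A)).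
Proof.
move=> AX tA; apply/truth_JustE; split; last exact/gtruth_kset.
by apply: evid_bang => //; have /truth_JustE[] := tA.
Qed.

Lemma emb_Just t X (A : folp) :
  emb D (Just t (vset X) A) = Just t (vset X) (emb D A).
Proof. by rewrite /emb /= map_vset. Qed.

Lemma inst_Just_vset f t (X : {fset nat}) A :
  inst (fun x => Some (f x)) (Just t (vset X) A) =
  Just t (kset [fset f x | x in X])
    (inst (fun x => if x \in X then Some (f x) else None) A).
Proof.
rewrite /=; congr Just.
  by rewrite /vset /kset -!imfset_comp; apply: eq_in_imfset.
by apply: inst_ext => x _; rewrite /restr in_vset.
Qed.

Lemma truth_inst_emb_Imp f (A B : folp) :
  truth M (inst (fun x => Some (f x)) (emb D (Imp A B))) <->
  (truth M (inst (fun x => Some (f x)) (emb D A)) ->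
   truth M (inst (fun x => Some (f x)) (emb D B))).
Proof. exact: truth_Imp. Qed.

Lemma inst_emb_subst f x y (A : folp) : free_for y x A ->
  inst (fun z => Some (f z)) (emb D (subst x (inl y) A)) =
  inst (fun z => Some (if z == x then f y else f z)) (emb D A).
Proof.
move=> yA; rewrite /emb map_subst (inst_subst_var (a := f y)) //.
  by apply: inst_ext => z _; rewrite /upd; case: eqP.
exact: free_for_map.
Qed.

Lemma fol_axiom_true (A : folp) : fol_axiom A -> gtruth (emb D A).
Proof.
have skip f x a (B : folp) : x \notin FVar B ->
    inst (fun y => Some (if y == x then a else f y)) (emb D B) =
    inst (fun y => Some (f y)) (emb D B).
  rewrite -(FVar_map (of_void D)) => xB; apply: inst_ext => y yB.
  by case: eqP => // yx; move: xB; rewrite -yx yB.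
have embA f x (B : folp) : truth M (inst (fun y => Some (f y)) (emb D (All x B)))
    <-> forall a,
      truth M (inst (fun y => Some (if y == x then a else f y)) (emb D B)).
  exact: truth_inst_All.
have embE f x (B : folp) : truth M (inst (fun y => Some (f y)) (emb D (Ex x B)))
    <-> exists a,
      truth M (inst (fun y => Some (if y == x then a else f y)) (emb D B)).
  exact: truth_inst_Ex.
case=> {A} [A B|A B C|A B|x y A yA|x A B xA|x y A yA|x A B xB] f;
  rewrite !truth_inst_emb_Imp.
- by [].
- by move=> ABC AB tA; apply: ABC tA (AB tA).
(* Contraposition is where classical logic enters. *)
- move=> nAB tB; apply: contrapT => nA; exact: nAB nA tB.
- by rewrite embA => /(_ (f y)); rewrite inst_emb_subst.
- rewrite !embA => AB tA a.
  by have /truth_inst_emb_Imp := AB a; apply; rewrite skip.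
- by rewrite embE inst_emb_subst // => tA; exists (f y).
- rewrite embA embE => AB [a tA].
  by have /truth_inst_emb_Imp/(_ tA) := AB a; rewrite skip.
Qed.

Lemma folp_axiom_true (A : folp) : folp_axiom A -> gtruth (emb D A).
Proof.
case=> {A} [A /fol_axiom_true//|t X y A yX yA|t X y A yX|s t X A|s t X A
  |s t X A B|t X A|t X A|t X x A xX] f; rewrite ?truth_inst_emb_Imp !emb_Just !inst_Just_vset.
(* The two partial assignments differ only at [y], which is not free in A. *)
- suff -> : inst (fun x => if x \in y |` X then Some (f x) else None) (emb D A) =
      inst (fun x => if x \in X then Some (f x) else None) (emb D A).
    by rewrite !truth_JustE.
  apply: inst_ext => x; rewrite FVar_map !inE.
  by case: eqP => // ->; rewrite (negbTE yA).
(* Enlarging the index set by [y] amounts to substituting [f y] for [y], under which both evidence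
   and truth of all instances are preserved. *)
- suff -> : inst (fun x => if x \in y |` X then Some (f x) else None) (emb D A) =
      subst y (inr (f y)) (inst (fun x => if x \in X then Some (f x) else None) (emb D A)).
    rewrite !truth_JustE => -[eA tA]; split; first exact: evid_inst.
    exact: gtruth_subst.
  rewrite subst_inst inst_comp; apply: inst_ext => x _.
  rewrite /orelse /upd !inE; case: (x \in X); rewrite ?orbT ?orbF //.
  by case: eqP => // ->.
- by rewrite !truth_JustE => -[eA tA]; split=> //; apply: evid_sum; left.
- by rewrite !truth_JustE => -[eA tA]; split=> //; apply: evid_sum; right.
- rewrite !truth_JustE => -[eAB tAB] [eA tA]; split; first exact: evid_app eAB eA.
  exact: gtruth_Imp tAB tA.
(* Completing the partial assignment on [X] by [f] gives back the full assignment [f]. *)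
- rewrite truth_JustE => -[_ /(_ f)]; rewrite inst_comp; congr truth.
  by apply: inst_ext => x _; rewrite /orelse; case: ifP.
- rewrite -emb_Just.
  set g := (fun x => if x \in X then _ else _).
  (* Exactly the variables in [X] are free in t:_X A, so on it [g] acts like the full assignment. *)
  have -> : inst g (emb D (Just t (vset X) A)) =
      Just t (kset [fset f x | x in X]) (inst g (emb D A)).
    rewrite emb_Just -inst_Just_vset; apply: inst_ext => x.
    by rewrite in_vars_in in_vset /g => ->.
  (* An embedded FOLP formula contains no domain members, so those of the instance are values of [f]
     on [X]. *)
  apply: truth_bang; apply/fsubsetP => a /consts_inst[|[x _]].
    by rewrite consts_emb.
  by rewrite /g; case: ifP => // xX [<-]; apply/imfsetP; exists x.
- rewrite !truth_JustE => -[eA tA].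
  (* As [x] is not in [X], the partial assignment is already undefined at the variable being
     bound. *)
  have -> : inst (fun y => if y \in X then Some (f y) else None) (emb D (All x A)) =
      All x (inst (fun y => if y \in X then Some (f y) else None) (emb D A)).
    congr All; apply: inst_ext => y _; rewrite /upd.
    by case: eqP => // ->; rewrite (negbTE xX).
  split; [exact: evid_gen|exact: gtruth_All].
Qed.

(** * Satisfiability along a tableau *)

Definition sat (b : seq (form nat)) (v : nat -> D) :=
  forall P : form nat, P \in b -> truth M (map_form v P).

Lemma truth_map_Neg (v : nat -> D) (P : form nat) :
  truth M (map_form v (Neg P)) <-> ~ truth M (map_form v P).
Proof. exact: truth_Neg. Qed.

(** The interpretation of the parameters may change from [v] to [w] because (T∃) and (F∀) must send
    the new parameter to a suitable element; all other rules keep [v], through [stay]. *)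
Lemma rule_sound b P C v : kform P -> P \in b -> rule b P C -> sat b v ->
  exists c w, [/\ c \in C, sat b w & sat c w].
Proof.
move=> kP Pb r bv.
have stay c : c \in C -> sat c v -> exists c w, [/\ c \in C, sat b w & sat c w].
  by move=> cC cv; exists c, v.
have sat1 (A : form nat) w : truth M (map_form w A) -> sat [:: A] w.
  by move=> tA B; rewrite inE => /eqP ->.
have satN (A : form nat) w : ~ truth M (map_form w A) -> sat [:: Neg A] w.
  by move=> nA; apply: sat1; apply/truth_Neg.
have fresh u a (A : form nat) : u \notin consts A ->
    map_form (fun n => if n == u then a else v n) A = map_form v A.
  by move=> uA; apply: map_form_ext => n nA; case: eqP nA uA => // -> ->.
have freshb u a : new_on b u -> sat b (fun n => if n == u then a else v n).
  by move=> nu A Ab; rewrite fresh ?nu //; apply: bv.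
have := bv _ Pb; case: r kP Pb stay => {P C} /=.
- move=> A _ _ stay tA; apply: stay (mem_head _ _) _; apply: sat1; exact: contrapT.
- move=> A B _ _ stay /truth_Imp tAB.
  have [tA|tA] := EM (truth M (map_form v A)).
    by apply: (stay [:: B]); rewrite ?inE ?eqxx ?orbT //; apply/sat1/tAB.
  by apply: (stay [:: Neg A]); rewrite ?inE ?eqxx //; apply: sat1.
- move=> A B _ _ stay /truth_Neg; rewrite truth_Imp => tAB.
  apply: stay (mem_head _ _) _ => F; rewrite !inE => /orP[]/eqP-> /=.
    by apply: contrapT => nA; apply: tAB.
  by move=> tB; apply: tAB.
- move=> x A u _ _ stay /truth_All tA; apply: stay (mem_head _ _) _.
  by apply: sat1; rewrite map_subst; apply: tA.
- move=> x A u _ _ stay /truth_Neg; rewrite truth_Ex => tA.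
  apply: stay (mem_head _ _) _; apply: satN; rewrite map_subst.
  by move=> tu; apply: tA; exists (v u).
- move=> x A u nu _ Pb _ /truth_Ex[a tA].
  (* The new parameter is sent to the witness [a]. It occurs neither on [b] nor in A, whose
     quantified form lies on [b], so everything else keeps its meaning. *)
  exists [:: subst x (inr u) A], (fun n => if n == u then a else v n).
  split; [exact: mem_head|exact: freshb|apply: sat1].
  by rewrite map_subst fresh ?(nu _ Pb) //= eqxx.
- move=> x A u nu _ Pb _ /truth_Neg; rewrite truth_All => tA.
  have /existsNP[a na] := tA.
  (* Here the new parameter is sent to a counterexample. *)
  exists [:: Neg (subst x (inr u) A)], (fun n => if n == u then a else v n).
  split; [exact: mem_head|exact: freshb|apply: sat1].
  by rewrite /= map_subst fresh ?(nu _ Pb) //= eqxx.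
- move=> t X A _ _ stay /truth_Just[_ tA]; apply: stay (mem_head _ _) _.
  by apply: sat1; rewrite map_uclos.
- move=> t s X A _ _ stay /truth_Neg; rewrite truth_JustE => nA.
  apply: stay (mem_head _ _) _ => F; rewrite !inE => /orP[]/eqP->;
    apply/truth_Neg => /truth_JustE => -[eA tA]; apply: nA; split=> //; apply: evid_sum; tauto.
- move=> s t X A B _ _ _ _ stay /truth_Neg; rewrite truth_JustE => nB.
  (* If t:_X A is false, the right branch is satisfied. Otherwise s:_X (A -> B) must be false, since
     application of evidence would make the premise's justified formula true. *)
  have [|tA] := EM (truth M (map_form v (Just t (kset X) A))); last first.
    by apply: (stay [:: Neg (Just t (kset X) A)]);
      rewrite ?inE ?eqxx ?orbT //; apply: sat1.
  move=> /truth_JustE[eA tA].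
  apply: stay (mem_head _ _) _; apply: satN => /truth_JustE[eAB tAB].
  apply: nB; split; [exact: evid_app eAB eA|exact: gtruth_Imp tAB tA].
(* The premise is a [Par]-formula, so the parameters of A lie in [X]; applying [v] gives the
   inclusion that [truth_bang] asks for. *)
- move=> t X A /Just_consts_kform/= /and3P[_ AX _] _ stay /truth_Neg; rewrite !map_kset => nA.
  apply: stay (mem_head _ _) _; apply: satN; rewrite /= map_kset => tA.
  apply/nA/truth_bang => //; rewrite consts_map; apply/fsubsetP => a.
  case/imfsetP => u /= /(fsubsetP AX); rewrite in_consts_in => uX ->.
  by case/imfsetP: uX => w /= wX [->]; apply/imfsetP; exists w.
- move=> t X u A _ _ _ stay /truth_Neg; rewrite truth_JustE => nA.
  by apply: stay (mem_head _ _) _; apply: satN => /truth_JustE.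
- move=> t X u A _ _ _ _ stay /truth_Neg; rewrite truth_JustE => nA.
  by apply: stay (mem_head _ _) _; apply: satN => /truth_JustE.
(* For (Ins), evidence for A(x) is evidence for each A(a), in particular for the value of the
   parameter. *)
- move=> t X x u A _ _ stay /truth_Neg; rewrite truth_JustE map_subst => nA.
  apply: stay (mem_head _ _) _; apply: satN => /truth_JustE[eA tA].
  apply: nA; split; [exact: evid_inst|exact: gtruth_subst].
- move=> x t X A _ _ stay /truth_Neg; rewrite truth_JustE => nA.
  apply: stay (mem_head _ _) _; apply: satN => /truth_JustE[eA tA].
  apply: nA; split; [exact: evid_gen|exact: gtruth_All].
Qed.

Lemma tableau_kform S T b (A : form nat) : tableau S T -> b \in T -> A \in b -> kform A.
Proof.
move=> tT; elim: tT b A => [kS b A|T1 b T2 P C _ IH Pb _ kC b' A].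
  by rewrite inE => /eqP-> /kS[].
rewrite !mem_cat => /or3P[bT|/mapP[c cC ->]|bT] Ab.
- by apply: IH Ab; rewrite mem_cat bT.
- move: Ab; rewrite mem_cat => /orP[Ab|Ac]; last by have [] := kC _ _ cC Ac.
  by apply: IH Ab; rewrite mem_cat inE eqxx orbT.
- by apply: IH Ab; rewrite mem_cat inE bT !orbT.
Qed.

(** If the satisfied branch is the one being extended, [rule_sound] selects one of its extensions
    and possibly a new interpretation; otherwise the branch survives unchanged. *)
Lemma tableau_sat S T v : tableau S T -> sat S v ->
  exists b w, b \in T /\ sat b w.
Proof.
move=> tT Sv; elim: tT => [_|T1 b T2 P C tT [b' [w [bT bw]]] Pb r kC].
  by exists S, v; rewrite mem_head.
move: bT; rewrite mem_cat inE => /or3P[bT|/eqP eb|bT].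
- by exists b', w; rewrite mem_cat bT.
- subst b'.
  have kP : kform P by apply: tableau_kform tT _ Pb; rewrite mem_cat mem_head orbT.
  have [c [w' [cC bw' cw']]] := rule_sound kP Pb r bw.
  exists (b ++ c), w'; split; last first.
    by move=> A; rewrite mem_cat => /orP[/bw'|/cw'].
  by rewrite !mem_cat map_f ?orbT.
- by exists b', w; rewrite !mem_cat bT !orbT.
Qed.

(** For a branch closed by [CS], the model condition on constants supplies the evidence, and A is an
    axiom, so all its instances are true. *)
Lemma closed_branch_unsat b v :
  constant_specification CS -> closed_branch CS b -> ~ sat b v.
Proof.
move=> hCS [A Ab nAb|c A cA nAb] bv; first exact: bv _ nAb (bv _ Ab).
have : ~ truth M (map_form v (emb nat (Just (TCst c) fset0 A))).
  by apply/truth_map_Neg; exact: bv _ nAb.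
rewrite map_emb; apply.
rewrite /emb /= truth_JustE; split.
  exact: evid_cst.
have [c' [A' [[_ ->] /folp_axiom_true]]] := hCS _ cA.
exact.
Qed.

End Soundness.

Theorem theorem3p1 (CS : folp -> Prop) (hCS : constant_specification CS)
    (A : folp) (hA : closed_form A) :
  tableau_provable CS A -> valid CS A.
Proof.
case=> T tT clT M; apply: contrapT => nA.
have [a] := dom_inhabited M.
(* An embedded sentence contains no parameters, so a constant interpretation serves as a start. *)
have nAv : @sat CS M [:: Neg (emb nat A)] (fun=> a).
  by move=> B; rewrite inE => /eqP->; apply/truth_map_Neg; rewrite map_emb.
have [b [v [bT bv]]] := tableau_sat tT nAv.
exact: closed_branch_unsat hCS (clT _ bT) bv.
Qed.
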